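(* Let $a,b>0$ be real, and for $0<x,y<1$ let $$D_F(x,y)=F(a,b;a+b;x)+F(a,b;a+b;y)-F(a,b;a+b;x+y-xy).$$ Then for all $0<x,y<1$, $$\frac{2R}{B}-1<D_F(x,y)\le 1,$$ where $R=R(a,b)=-2\gamma-\psi(a)-\psi(b)$ and $B=B(a,b)$.
   Context: $F(a,b;c;x)=\sum_{n=0}^{\infty}\frac{(a,n)(b,n)}{(c,n)}\frac{x^n}{n!}$ for $|x|<1$ is the Gaussian hypergeometric function, where $(a,0)=1$ and $(a,n)=a(a+1)\cdots(a+n-1)$ for $n\ge 1$. $\Gamma$ is the Euler gamma function, $\psi=\Gamma'/\Gamma$ is the psi (digamma) function, $B(a,b)=\Gamma(a)\Gamma(b)/\Gamma(a+b)$ is the beta function, and $\gamma$ is the Euler–Mascheroni constant. *)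

(* Defs.v *)
From Stdlib Require Import Reals Factorial.
From Coquelicot Require Import Coquelicot.

Local Open Scope R_scope.

(* Rising factorial (a,n) = a (a+1) ... (a+n-1), with (a,0) = 1. *)
Fixpoint poch (a : R) (n : nat) : R :=
  match n with
  | O => 1
  | S m => poch a m * (a + INR m)
  end.

(* Gaussian hypergeometric series; only meaningful for |x| < 1 and c not in
   {0, -1, -2, ...}, PSeries and division being total. *)
Definition hyp2F1 (a b c x : R) : R :=
  PSeries (fun n => poch a n * poch b n / (poch c n * INR (fact n))) x.

(* Euler's integral, improper at both ends; only meaningful for s > 0. *)
Definition Gamma (s : R) : R :=
  RInt_gen (fun t => Rpower t (s - 1) * exp (- t))
    (at_right 0) (Rbar_locally p_infty).

Definition digamma (s : R) : R := Derive Gamma s / Gamma s.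

Definition Beta (a b : R) : R := Gamma a * Gamma b / Gamma (a + b).

(* Euler-Mascheroni constant: lim (1 + 1/2 + ... + 1/n - ln n). *)
Definition euler_gamma : R :=
  real (Lim_seq (fun n => sum_n_m (fun k => / INR k) 1 n - ln (INR n))).

Definition Ramanujan_R (a b : R) : R :=
  - 2 * euler_gamma - digamma a - digamma b.

Definition D_F (a b x y : R) : R :=
  hyp2F1 a b (a + b) x + hyp2F1 a b (a + b) y
  - hyp2F1 a b (a + b) (x + y - x * y).

(* Main.v *)
Require Import Defs.
From Stdlib Require Import Reals Lra Lia.
From Coquelicot Require Import Coquelicot.

(* Write B F(x) = sum e_n x^n, so that e_n is a ratio of Gamma values. As
   (n+1) e_(n+1) - n e_n = e_n ab/(a+b+n) > 0, the sequence n e_n increases; its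
   limit is 1 by log-convexity of Gamma. Hence Phi(x) = B F(x) + ln(1-x) is a power
   series with negative coefficients e_n - 1/n beyond the constant term e_0 = B:
   it decreases from B and stays above e_0 + sum (e_n - 1/n).
   That sum is at least R: sum_(n<N) e_n(a,b) decreases in a and drops by exactly
   N e_N(a,b)/a when a becomes a+1, which allows a comparison with a = 1, and then
   with b = 1, where e_n = 1/(n+1); the corrections are the partial sums of the
   series for the digamma function.
   With 1-z = (1-x)(1-y) the logarithms cancel in
   B D_F(x,y) = Phi(x) + Phi(y) - Phi(z) > Phi(x) >= R > 2R - B.
   For the upper bound, (1-x) F'(x) has positive coefficients, so it increases, and
   D_F(x,y) decreases in y from its value 1 at y = 0. *)

Local Open Scope R_scope.

(** * Euler's integral *)

Lemma ex_RInt_continuous_pos (g : R -> R) (a b : R) :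
  (forall t, 0 < t -> continuous g t) -> 0 < a -> 0 < b -> ex_RInt g a b.
Proof.
  intros Hg Ha Hb. apply (ex_RInt_continuous (V := R_CompleteNormedModule)).
  intros z [Hz _]. apply Hg. revert Hz. apply Rmin_case; lra.
Qed.

Lemma RInt_mono_interval (g : R -> R) (a b c d : R) :
  (forall t, 0 < t -> continuous g t) -> (forall t, 0 < t -> 0 <= g t) ->
  0 < c <= a -> a <= b <= d -> RInt g a b <= RInt g c d.
Proof.
  intros Hg Hp Hc Hb.
  assert (E : forall u v, 0 < u -> 0 < v -> ex_RInt g u v)
    by (intros; now apply ex_RInt_continuous_pos).
  assert (E1 : RInt g c d = RInt g c a + (RInt g a b + RInt g b d)).
  { rewrite <- (RInt_Chasles (V := R_CompleteNormedModule) g c a d)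
      by (apply E; lra).
    now rewrite <- (RInt_Chasles (V := R_CompleteNormedModule) g a b d)
      by (apply E; lra). }
  assert (0 <= RInt g c a)
    by (apply RInt_ge_0; [lra | apply E; lra | intros; apply Hp; lra]).
  assert (0 <= RInt g b d)
    by (apply RInt_ge_0; [lra | apply E; lra | intros; apply Hp; lra]).
  lra.
Qed.

Lemma filter_prod_pos_infty (P : R * R -> Prop) (a b : R) :
  0 < a -> (forall u v, 0 < u < a -> b < v -> P (u, v)) ->
  filter_prod (at_right 0) (Rbar_locally p_infty) P.
Proof.
  intros Ha HP.
  apply Filter_prod with (fun u => 0 < u < a) (fun v => b < v).
  - exists (mkposreal a Ha). intros u Hu Hu0.
    unfold ball in Hu; simpl in Hu; unfold AbsRing_ball, abs, minus, plus, opp in Hu; simpl in Hu.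
    apply Rabs_def2 in Hu. lra.
  - exists b. auto.
  - exact HP.
Qed.

(** For a nonnegative integrand, widening the interval increases the integral, so the improper
    integral is the supremum of the proper ones. *)
Lemma is_RInt_gen_bounded (g : R -> R) (K : R) :
  (forall t, 0 < t -> continuous g t) -> (forall t, 0 < t -> 0 <= g t) ->
  (forall a b, 0 < a <= b -> RInt g a b <= K) ->
  exists l, is_RInt_gen g (at_right 0) (Rbar_locally p_infty) l
    /\ forall a b, 0 < a <= b -> RInt g a b <= l.
Proof.
  intros Hg Hp HK.
  pose (E := fun r => exists a b, 0 < a <= b /\ r = RInt g a b).
  destruct (completeness E) as [l [Hub Hlub]].
  { exists K. intros r (a & b & Hab & ->). auto. }
  { exists (RInt g 1 1), 1, 1. lra. }
  exists l. split.
  2:{ intros a b Hab. apply Hub. now exists a, b. }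
  intros P [eps HP].
  assert (Hex : exists a b, 0 < a <= b /\ l - eps < RInt g a b).
  { apply Classical_Prop.NNPP. intros N.
    assert (l <= l - eps).
    { apply Hlub. intros r (a & b & Hab & ->). apply Rnot_lt_le. intros H.
      apply N. now exists a, b. }
    destruct eps as [e He]; simpl in *; lra. }
  destruct Hex as (a & b & Hab & Hl).
  apply filter_prod_pos_infty with a b; [lra|].
  intros u v Hu Hv. exists (RInt g u v). split.
  - apply (RInt_correct (V := R_CompleteNormedModule)),  ex_RInt_continuous_pos; simpl; auto; lra.
  - apply HP.
    assert (RInt g u v <= l) by (apply Hub; exists u, v; lra).
    assert (RInt g a b <= RInt g u v) by (apply RInt_mono_interval; auto; lra).
    unfold ball; simpl; unfold AbsRing_ball, abs, minus, plus, opp; simpl.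
    apply Rabs_def1; lra.
Qed.

(** A named copy of the integrand inside [Gamma], identified with it by conversion in
    [is_RInt_gen_Gamma]. *)
Definition gamma_integrand (s t : R) : R := Rpower t (s - 1) * exp (- t).

Lemma is_RInt_gen_Gamma (s l : R) :
  is_RInt_gen (gamma_integrand s) (at_right 0) (Rbar_locally p_infty) l ->
  Gamma s = l.
Proof.
  intros H. exact (is_RInt_gen_unique (V := R_CompleteNormedModule) (gamma_integrand s) l H).
Qed.

Lemma continuous_gamma_integrand (s t : R) :
  0 < t -> continuous (gamma_integrand s) t.
Proof.
  intros Ht. apply (ex_derive_continuous (V := R_NormedModule)).
  unfold gamma_integrand, Rpower. auto_derive. auto.
Qed.

Lemma gamma_integrand_pos (s t : R) : 0 < gamma_integrand s t.
Proof. apply Rmult_lt_0_compat; apply exp_pos. Qed.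

Lemma ln_le_sub_1 (x : R) : 0 < x -> ln x <= x - 1.
Proof.
  intros Hx. assert (H := exp_ineq1_le (ln x)). rewrite exp_ln in H; lra.
Qed.

(* [(t / (1 + t))^s / s] is a bounded primitive of [t^(s-1) / (1+t)^(s+1)], so
   this domination makes the Euler integrand integrable at both ends. *)
Lemma Rpower_1p_mul_exp_le (s t : R) : 0 < s -> 0 < t ->
  Rpower (1 + t) (s + 1) * exp (- t) <= exp ((s + 1) * ln (s + 1) - s).
Proof.
  intros Hs Ht. unfold Rpower. rewrite <- exp_plus.
  (* The exponent [(s + 1) * ln (1 + t) - t] is maximal at [t = s]; this is its tangent bound
     there. *)
  assert (H : ln ((1 + t) / (s + 1)) <= (1 + t) / (s + 1) - 1).
  { apply ln_le_sub_1. apply Rdiv_lt_0_compat; lra. }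
  rewrite ln_div in H by lra.
  apply (Rmult_le_compat_l (s + 1)) in H; [|lra].
  replace ((s + 1) * ((1 + t) / (s + 1) - 1)) with (t - s) in H by (field; lra).
  destruct (Req_dec ((s + 1) * ln (1 + t) + - t) ((s + 1) * ln (s + 1) - s)) as [->|N].
  - lra.
  - left. apply exp_increasing. lra.
Qed.

Lemma is_derive_beta_primitive (s t : R) : 0 < s -> 0 < t ->
  is_derive (fun t => Rpower (t / (1 + t)) s / s) t
    (Rpower t (s - 1) / Rpower (1 + t) (s + 1)).
Proof.
  intros Hs Ht. unfold Rpower.
  assert (0 < t / (1 + t)) by (apply Rdiv_lt_0_compat; lra).
  auto_derive.
  - repeat split; lra.
  - replace (t * / (1 + t)) with (t / (1 + t)) by reflexivity.
    rewrite ln_div by lra.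
    replace ((s - 1) * ln t) with (s * (ln t - ln (1 + t)) + s * ln (1 + t) + - ln t) by ring.
    replace ((s + 1) * ln (1 + t)) with (s * ln (1 + t) + ln (1 + t)) by ring.
    rewrite !exp_plus, exp_Ropp, !exp_ln by lra.
    assert (0 < exp (s * ln (1 + t))) by apply exp_pos.
    field. lra.
Qed.

(** The primitive [W] of the dominating function takes values between 0 and [/ s], which makes the
    bound uniform in the endpoints. *)
Lemma RInt_gamma_integrand_le (s a b : R) : 0 < s -> 0 < a <= b ->
  RInt (gamma_integrand s) a b <= exp ((s + 1) * ln (s + 1) - s) * / s.
Proof.
  intros Hs Hab. set (C := exp ((s + 1) * ln (s + 1) - s)).
  assert (HC : 0 < C) by apply exp_pos.
  set (w := fun t => Rpower t (s - 1) / Rpower (1 + t) (s + 1)).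
  set (W := fun t => Rpower (t / (1 + t)) s / s).
  assert (Hw : is_RInt w a b (minus (W b) (W a))).
  { apply (is_RInt_derive (V := R_CompleteNormedModule)).
    - intros x Hx. rewrite Rmin_left, Rmax_right in Hx by lra.
      apply is_derive_beta_primitive; lra.
    - intros x Hx. rewrite Rmin_left, Rmax_right in Hx by lra.
      apply (ex_derive_continuous (V := R_NormedModule)). unfold w, Rpower. auto_derive.
      repeat split; try lra. apply Rgt_not_eq, exp_pos. }
  apply Rle_trans with (RInt (fun t => C * w t) a b).
  - apply RInt_le; [lra | | |].
    + apply ex_RInt_continuous_pos; try lra. apply continuous_gamma_integrand.
    + exists (scal C (minus (W b) (W a))).
      now apply (is_RInt_scal (V := R_NormedModule)).
    + intros t Ht. unfold gamma_integrand, w.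
      assert (H := Rpower_1p_mul_exp_le s t Hs ltac:(lra)). fold C in H.
      assert (P1 : 0 < Rpower t (s - 1)) by apply exp_pos.
      assert (P2 : 0 < Rpower (1 + t) (s + 1)) by apply exp_pos.
      replace (C * (Rpower t (s - 1) / Rpower (1 + t) (s + 1)))
        with (Rpower t (s - 1) * (C / Rpower (1 + t) (s + 1))) by (field; lra).
      apply Rmult_le_compat_l; [lra|].
      apply Rle_div_r; [exact P2 | lra].
  - rewrite (is_RInt_unique _ _ _ (scal C (minus (W b) (W a)))).
    2:{ now apply (is_RInt_scal (V := R_NormedModule)). }
    unfold scal, minus, plus, opp; simpl; unfold mult; simpl.
    apply Rmult_le_compat_l; [lra|]. unfold W.
    assert (Rpower (b / (1 + b)) s <= 1).
    { apply Rle_trans with (exp 0); [|rewrite exp_0; lra].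
      unfold Rpower. rewrite ln_div by lra.
      assert (ln b < ln (1 + b)) by (apply ln_increasing; lra).
      left. apply exp_increasing. nra. }
    assert (0 < Rpower (a / (1 + a)) s) by apply exp_pos.
    unfold Rdiv. assert (0 < / s) by now apply Rinv_0_lt_compat. nra.
Qed.

Lemma Gamma_correct (s : R) : 0 < s ->
  is_RInt_gen (gamma_integrand s) (at_right 0) (Rbar_locally p_infty) (Gamma s)
  /\ 0 < Gamma s.
Proof.
  intros Hs.
  destruct (is_RInt_gen_bounded (gamma_integrand s)
    (exp ((s + 1) * ln (s + 1) - s) * / s)) as (l & Hl & Hub).
  - apply continuous_gamma_integrand.
  - intros t _. left. apply gamma_integrand_pos.
  - intros a b. now apply RInt_gamma_integrand_le.
  - assert (E : Gamma s = l) by now apply is_RInt_gen_Gamma.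
    rewrite E. split; [exact Hl|].
    apply Rlt_le_trans with (RInt (gamma_integrand s) 1 2).
    + apply RInt_gt_0; [lra | intros; apply gamma_integrand_pos |].
      intros; apply continuous_gamma_integrand; lra.
    + apply Hub; lra.
Qed.

Lemma Gamma_pos (s : R) : 0 < s -> 0 < Gamma s.
Proof. apply Gamma_correct. Qed.

(** The fundamental theorem of calculus on the open half-line; it serves both the value of [Gamma]
    at 1 and the functional equation. *)
Lemma is_RInt_gen_derive_pos (h dh : R -> R) (l0 l1 : R) :
  (forall t, 0 < t -> is_derive h t (dh t)) ->
  (forall t, 0 < t -> continuous dh t) ->
  filterlim h (at_right 0) (locally l0) ->
  filterlim h (Rbar_locally p_infty) (locally l1) ->
  is_RInt_gen dh (at_right 0) (Rbar_locally p_infty) (l1 - l0).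
Proof.
  intros Hd Hc H0 H1.
  assert (Hpos : forall u v x, 0 < u -> 1 < v -> Rmin u v <= x -> 0 < x).
  { intros u v x Hu Hv. apply Rmin_case; lra. }
  apply is_RInt_gen_ext with (Derive h).
  - apply filter_prod_pos_infty with 1 1; [lra|].
    intros u v Hu Hv x [Hx _]; simpl in Hx.
    apply is_derive_unique, Hd. apply (Hpos u v); lra.
  - apply is_RInt_gen_Derive; auto.
    + apply filter_prod_pos_infty with 1 1; [lra|].
      intros u v Hu Hv x [Hx _]; simpl in Hx.
      exists (dh x). apply Hd. apply (Hpos u v); lra.
    + apply filter_prod_pos_infty with 1 1; [lra|].
      intros u v Hu Hv x [Hx _]; simpl in Hx.
      assert (Px : 0 < x) by (apply (Hpos u v); lra).
      apply (continuous_ext_loc _ dh); [|now apply Hc].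
      exists (mkposreal x Px). intros y Hy.
      unfold ball in Hy; simpl in Hy; unfold AbsRing_ball, abs, minus, plus, opp in Hy; simpl in Hy.
      apply Rabs_def2 in Hy.
      symmetry. apply is_derive_unique, Hd. lra.
Qed.

Lemma Gamma_1 : Gamma 1 = 1.
Proof.
  (* The value keeps the shape limit at infinity minus limit at 0 of the primitive [- exp (- t)]. *)
  assert (I : is_RInt_gen (gamma_integrand 1) (at_right 0) (Rbar_locally p_infty) (- 0 - - 1)).
  2:{ replace 1 with (- 0 - - 1) at 2 by ring. now apply is_RInt_gen_Gamma. }
  apply (is_RInt_gen_derive_pos (fun t => - exp (- t))).
  - intros t Ht. unfold gamma_integrand, Rpower. auto_derive; auto.
    replace (1 - 1) with 0 by ring. rewrite Rmult_0_l, exp_0. ring.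
  - intros t Ht. now apply (continuous_gamma_integrand 1).
  - replace (- 1) with (- exp (- 0)) by (rewrite Ropp_0, exp_0; ring).
    eapply filterlim_filter_le_1; [apply filter_le_within|].
    apply (ex_derive_continuous (V := R_NormedModule) (fun t => - exp (- t))). auto_derive. auto.
  - apply (is_lim_opp (fun t => exp (- t)) p_infty 0).
    apply (is_lim_comp exp Ropp p_infty 0 m_infty).
    + apply is_lim_exp_m.
    + apply (is_lim_opp (fun x => x) p_infty p_infty), is_lim_id.
    + exists 0. intros; discriminate.
Qed.

(** Integration by parts: [h] is t^s exp(-t), which vanishes at both ends, and its derivative is the
    difference of the two integrands. *)
Lemma Gamma_succ (s : R) : 0 < s -> Gamma (s + 1) = s * Gamma s.
Proof.
  intros Hs.
  destruct (Gamma_correct s Hs) as [I0 _].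
  destruct (Gamma_correct (s + 1) ltac:(lra)) as [I1 _].
  pose (h := fun t => Rpower t s * exp (- t)).
  assert (Hdom : forall t, 0 < t -> exp (- t) <= 1).
  { intros t Ht. rewrite <- exp_0. left. apply exp_increasing. lra. }
  assert (I : is_RInt_gen (fun t => s * gamma_integrand s t - gamma_integrand (s + 1) t)
     (at_right 0) (Rbar_locally p_infty) (0 - 0)).
  { apply (is_RInt_gen_derive_pos h).
    - intros t Ht. unfold h, gamma_integrand, Rpower. auto_derive; auto.
      replace (s + 1 - 1) with s by ring.
      replace ((s - 1) * ln t) with (s * ln t + - ln t) by ring.
      rewrite !exp_plus, (exp_Ropp (ln t)), exp_ln by lra. field. lra.
    - intros t Ht. apply (ex_derive_continuous (V := R_NormedModule)).
      unfold gamma_integrand, Rpower. auto_derive. auto.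
    (* Near 0, [h t <= t^s], which is below [eps] once t < eps^(1/s). *)
    - intros P [eps HP].
      exists (mkposreal (Rpower eps (/ s)) (exp_pos _)). intros t Ht Ht0. apply HP.
      unfold ball in *; simpl in *; unfold AbsRing_ball, abs, minus, plus, opp in *; simpl in *.
      rewrite Ropp_0, Rplus_0_r in *. rewrite Rabs_pos_eq in Ht by lra.
      unfold h. rewrite Rabs_pos_eq
        by (left; apply Rmult_lt_0_compat; apply exp_pos).
      destruct eps as [e He]; simpl in *.
      assert (Rpower t s < e).
      { replace e with (Rpower (Rpower e (/ s)) s).
        - apply Rlt_Rpower_l; lra.
        - rewrite Rpower_mult, Rinv_l, Rpower_1; lra. }
      assert (0 < Rpower t s) by apply exp_pos.
      specialize (Hdom t Ht0). assert (0 < exp (- t)) by apply exp_pos. nra.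
    (* At infinity, [Rpower_1p_mul_exp_le] gives [h t <= C / (1 + t)], hence the threshold
       [C / eps]; the maximum with 0 keeps t positive. *)
    - set (C := exp ((s + 1) * ln (s + 1) - s)).
      intros P [eps HP]. exists (Rmax 0 (C / eps)). intros t Ht. apply HP.
      assert (Ht0 : 0 < t) by (apply Rle_lt_trans with (2 := Ht), Rmax_l).
      assert (Ht1 : C / eps < t) by (apply Rle_lt_trans with (2 := Ht), Rmax_r).
      unfold ball in *; simpl in *; unfold AbsRing_ball, abs, minus, plus, opp in *; simpl in *.
      rewrite Ropp_0, Rplus_0_r in *.
      unfold h. rewrite Rabs_pos_eq
        by (left; apply Rmult_lt_0_compat; apply exp_pos).
      destruct eps as [e He]; simpl in *.
      assert (B := Rpower_1p_mul_exp_le s t Hs Ht0). fold C in B.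
      rewrite Rpower_plus, Rpower_1 in B by lra.
      assert (Rpower t s <= Rpower (1 + t) s).
      { left. apply Rlt_Rpower_l; lra. }
      assert (0 < exp (- t)) by apply exp_pos.
      apply Rlt_div_l in Ht1; [|lra].
      assert (0 < Rpower t s) by apply exp_pos.
      assert (Rpower t s * exp (- t) <= Rpower (1 + t) s * exp (- t)) by nra.
      apply Rmult_lt_reg_r with (1 + t); [lra|]. nra. }
  assert (J := is_RInt_gen_minus _ _ _ _ (is_RInt_gen_scal _ s _ I0) I1).
  assert (E : 0 - 0 = s * Gamma s - Gamma (s + 1)).
  { rewrite <- (is_RInt_gen_unique (V := R_CompleteNormedModule) _ _ I).
    exact (is_RInt_gen_unique (V := R_CompleteNormedModule) _ _ J). }
  lra.
Qed.

(* Young's inequality applied pointwise to the two normalised integrands. *)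
Lemma ln_Gamma_convex (s t la : R) : 0 < s -> 0 < t -> 0 <= la <= 1 ->
  ln (Gamma ((1 - la) * s + la * t)) <= (1 - la) * ln (Gamma s) + la * ln (Gamma t).
Proof.
  intros Hs Ht Hla.
  set (m := (1 - la) * s + la * t).
  assert (Hm : 0 < m) by (unfold m; nra).
  destruct (Gamma_correct s Hs) as [Is Ps].
  destruct (Gamma_correct t Ht) as [It Pt].
  destruct (Gamma_correct m Hm) as [Im Pm].
  set (M := (1 - la) * ln (Gamma s) + la * ln (Gamma t)).
  (* Convexity of [exp], from its tangent at the intermediate point [c]. *)
  assert (Y : forall u v, exp ((1 - la) * u + la * v) <= (1 - la) * exp u + la * exp v).
  { intros u v. set (c := (1 - la) * u + la * v).
    assert (Hu := exp_ineq1_le (u - c)). assert (Hv := exp_ineq1_le (v - c)).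
    replace u with (c + (u - c)) at 1 by ring.
    replace v with (c + (v - c)) at 1 by ring.
    rewrite !exp_plus. assert (Hc := exp_pos c).
    assert ((1 - la) * (1 + (u - c)) <= (1 - la) * exp (u - c)) by (apply Rmult_le_compat_l; lra).
    assert (la * (1 + (v - c)) <= la * exp (v - c)) by (apply Rmult_le_compat_l; lra).
    assert ((1 - la) * (1 + (u - c)) + la * (1 + (v - c)) = 1) by (unfold c; ring).
    nra. }
  (* The dominating integral is [(1 - la) + la = 1]. The dominated integrand is positive, so
     comparing norms compares the integrals. *)
  assert (J := is_RInt_gen_plus _ _ _ _
    (is_RInt_gen_scal _ ((1 - la) * / Gamma s) _ Is)
    (is_RInt_gen_scal _ (la * / Gamma t) _ It)).
  assert (K := is_RInt_gen_scal _ (exp (- M)) _ Im).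
  assert (H : norm (scal (exp (- M)) (Gamma m))
     <= plus (scal ((1 - la) * / Gamma s) (Gamma s)) (scal (la * / Gamma t) (Gamma t))).
  { refine (RInt_gen_norm _ _ _ _ _ _ K J).
    - apply filter_prod_pos_infty with 1 1; [lra|]. intros; simpl; lra.
    - apply filter_prod_pos_infty with 1 1; [lra|].
      intros u v Hu Hv x Hx; simpl in Hx.
      unfold norm, plus, scal; simpl; unfold abs, mult; simpl.
      rewrite Rabs_pos_eq by (left; apply Rmult_lt_0_compat;
        [apply exp_pos | apply gamma_integrand_pos]).
      assert (Z := Y ((s - 1) * ln x - x - ln (Gamma s)) ((t - 1) * ln x - x - ln (Gamma t))).
      replace ((1 - la) * ((s - 1) * ln x - x - ln (Gamma s)) +
         la * ((t - 1) * ln x - x - ln (Gamma t)))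
        with (- M + ((m - 1) * ln x + - x)) in Z by (unfold M, m; ring).
      unfold Rminus in Z; rewrite !exp_plus, (exp_Ropp (ln _)), (exp_Ropp (ln (Gamma t))), !exp_ln in Z by lra.
      unfold gamma_integrand, Rpower, Rminus. lra. }
  unfold norm, plus, scal in H; simpl in H; unfold abs, mult in H; simpl in H.
  rewrite Rabs_pos_eq in H by (left; apply Rmult_lt_0_compat; [apply exp_pos | lra]).
  replace ((1 - la) * / Gamma s * Gamma s + la * / Gamma t * Gamma t) with 1 in H
    by (field; lra).
  rewrite exp_Ropp in H.
  assert (HM : 0 < exp M) by apply exp_pos.
  assert (Gamma m <= exp M).
  { apply Rmult_le_reg_l with (/ exp M); [now apply Rinv_0_lt_compat|].
    rewrite Rinv_l; lra. }
  rewrite <- (ln_exp M). now apply ln_le.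
Qed.

(** * The digamma function *)

Lemma ln_Gamma_succ (s : R) : 0 < s -> ln (Gamma (s + 1)) = ln (Gamma s) + ln s.
Proof.
  intros Hs. rewrite Gamma_succ, ln_mult by (auto using Gamma_pos). ring.
Qed.

(** Convexity with [q] as the intermediate point and denominators cleared, a form that [nra] can use
    directly. *)
Lemma ln_Gamma_slopes (p q r : R) : 0 < p < q -> q < r ->
  (r - p) * ln (Gamma q) <= (r - q) * ln (Gamma p) + (q - p) * ln (Gamma r).
Proof.
  intros Hp Hq.
  assert (Hd : 0 < / (r - p)) by (apply Rinv_0_lt_compat; lra).
  assert (H := ln_Gamma_convex p r ((q - p) / (r - p)) ltac:(lra) ltac:(lra)).
  replace ((1 - (q - p) / (r - p)) * p + (q - p) / (r - p) * r) with q in H by (field; lra).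
  assert (H' := H ltac:(split; [apply Rle_div_r | apply Rle_div_l]; lra)).
  apply (Rmult_le_compat_l (r - p)) in H'; [|lra].
  replace ((r - q) * ln (Gamma p) + (q - p) * ln (Gamma r)) with
    ((r - p) * ((1 - (q - p) / (r - p)) * ln (Gamma p) + (q - p) / (r - p) * ln (Gamma r)))
    by (field; lra).
  exact H'.
Qed.

(** By convexity the slope over [u, u+h] lies between those over [u-1, u] and [u+h, u+h+1], which
    the functional equation evaluates. *)
Lemma ln_Gamma_shift_bounds (u h : R) : 1 < u -> 0 < h ->
  h * ln (u - 1) <= ln (Gamma (u + h)) - ln (Gamma u) <= h * ln (u + h).
Proof.
  intros Hu Hh. split.
  - assert (H := ln_Gamma_slopes (u - 1) u (u + h) ltac:(lra) ltac:(lra)).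
    assert (E := ln_Gamma_succ (u - 1) ltac:(lra)).
    replace (u - 1 + 1) with u in E by ring. nra.
  - assert (H := ln_Gamma_slopes u (u + h) (u + h + 1) ltac:(lra) ltac:(lra)).
    rewrite ln_Gamma_succ in H by lra. nra.
Qed.

Lemma is_lim_seq_div_shift (c p : R) : is_lim_seq (fun n => c / (p + INR n)) 0.
Proof.
  assert (H : is_lim_seq (fun n => p + INR n) p_infty).
  { apply (is_lim_seq_plus _ _ p p_infty); [apply is_lim_seq_const | apply is_lim_seq_INR | reflexivity]. }
  assert (H1 := is_lim_seq_inv _ _ H ltac:(discriminate)).
  replace (Finite 0) with (Rbar_mult c 0) by (simpl; f_equal; ring).
  now apply is_lim_seq_scal_l.
Qed.

Lemma eventually_shift_pos (p : R) : eventually (fun n => 0 < p + INR n).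
Proof.
  destruct (INR_unbounded (- p)) as [N HN]. exists N. intros n Hn.
  apply le_INR in Hn. lra.
Qed.

Lemma is_lim_seq_ln_shift (p q : R) :
  is_lim_seq (fun n => ln (p + INR n) - ln (q + INR n)) 0.
Proof.
  assert (B : forall x y, 0 < x -> 0 < y -> ln x - ln y <= (x - y) / y).
  { intros x y Hx Hy. rewrite <- ln_div by lra.
    replace ((x - y) / y) with (x / y - 1) by (field; lra).
    apply ln_le_sub_1, Rdiv_lt_0_compat; lra. }
  apply is_lim_seq_le_le_loc with
    (fun n => (p - q) / (p + INR n)) (fun n => (p - q) / (q + INR n)).
  - generalize (filter_and _ _ (eventually_shift_pos p) (eventually_shift_pos q)).
    apply filter_imp. intros n [Hp Hq]. split.
    + assert (H := B _ _ Hq Hp).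
      replace (q + INR n - (p + INR n)) with (- (p - q)) in H by ring.
      unfold Rdiv in *. lra.
    + assert (H := B _ _ Hp Hq).
      now replace (p + INR n - (q + INR n)) with (p - q) in H by ring.
  - apply is_lim_seq_div_shift.
  - apply is_lim_seq_div_shift.
Qed.

(** In multiplicative form, Gamma(s+n+h)/Gamma(s+n) is equivalent to (s+n)^h. *)
Lemma is_lim_seq_Gamma_ratio_pos (s h : R) : 0 < s -> 0 < h ->
  is_lim_seq (fun n => ln (Gamma (s + INR n + h)) - ln (Gamma (s + INR n))
     - h * ln (s + INR n)) 0.
Proof.
  intros Hs Hh.
  apply is_lim_seq_le_le_loc with
    (fun n => h * (ln (s - 1 + INR n) - ln (s + INR n)))
    (fun n => h * (ln (s + h + INR n) - ln (s + INR n))).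
  - exists 1%nat. intros n Hn. apply le_INR in Hn. simpl in Hn.
    destruct (ln_Gamma_shift_bounds (s + INR n) h ltac:(lra) Hh) as [H1 H2].
    replace (s - 1 + INR n) with (s + INR n - 1) by ring.
    replace (s + h + INR n) with (s + INR n + h) by ring. lra.
  - replace (Finite 0) with (Rbar_mult h 0) by (simpl; f_equal; ring).
    apply is_lim_seq_scal_l, is_lim_seq_ln_shift.
  - replace (Finite 0) with (Rbar_mult h 0) by (simpl; f_equal; ring).
    apply is_lim_seq_scal_l, is_lim_seq_ln_shift.
Qed.

Lemma is_lim_seq_Gamma_ratio (s h : R) : 0 < s -> 0 < s + h ->
  is_lim_seq (fun n => ln (Gamma (s + INR n + h)) - ln (Gamma (s + INR n))
     - h * ln (s + INR n)) 0.
Proof.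
  intros Hs Hh.
  destruct (Rtotal_order 0 h) as [H|[<-|H]].
  - now apply is_lim_seq_Gamma_ratio_pos.
  - apply is_lim_seq_ext with (fun _ => 0); [|apply is_lim_seq_const].
    intros n. rewrite Rplus_0_r. ring.
  (* For negative [h] the ratio is inverted, starting from [s + h]; [K] then changes the base of the
     power back to [s + INR n]. *)
  - assert (L := is_lim_seq_Gamma_ratio_pos (s + h) (- h) Hh ltac:(lra)).
    assert (K := is_lim_seq_ln_shift s (s + h)).
    apply (is_lim_seq_scal_l _ (-1)) in L.
    apply (is_lim_seq_scal_l _ (- h)) in K.
    assert (M := is_lim_seq_plus' _ _ _ _ L K).
    replace (Finite 0) with (Finite (-1 * 0 + - h * 0)) by (f_equal; ring).
    revert M. apply is_lim_seq_ext. intros n.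
    replace (s + h + INR n + - h) with (s + INR n) by ring.
    replace (s + h + INR n) with (s + INR n + h) by ring. ring.
Qed.

(** The sum runs over k < n and is empty at 0, whereas [sum_n] includes its upper index. *)
Fixpoint psum (u : nat -> R) (n : nat) : R :=
  match n with
  | O => 0
  | S m => psum u m + u m
  end.

Lemma psum_ext (u v : nat -> R) (n : nat) :
  (forall k, u k = v k) -> psum u n = psum v n.
Proof. intros H. induction n; simpl; congruence. Qed.

Lemma psum_le (u v : nat -> R) (n : nat) :
  (forall k, u k <= v k) -> psum u n <= psum v n.
Proof.
  intros H. induction n; simpl; [lra|]. specialize (H n). lra.
Qed.

Lemma is_lim_seq_psum (u : nat -> nat -> R) (v : nat -> R) (m : nat) :
  (forall k, is_lim_seq (fun n => u n k) (v k)) ->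
  is_lim_seq (fun n => psum (u n) m) (psum v m).
Proof.
  intros H. induction m; simpl.
  - apply is_lim_seq_const.
  - now apply is_lim_seq_plus'.
Qed.

Lemma sum_n_psum (u : nat -> R) (n : nat) : sum_n u n = psum u (S n).
Proof.
  induction n.
  - rewrite sum_O. simpl. ring.
  - rewrite sum_Sn, IHn. reflexivity.
Qed.

(** Approximants in Gauss's limit formula for the digamma function; with [s + INR n] inside the
    logarithm they decrease. *)
Definition digamma_seq (s : R) (n : nat) : R :=
  ln (s + INR n) - psum (fun k => / (s + INR k)) n.

Lemma ex_finite_lim_digamma_seq (s : R) : 0 < s ->
  ex_finite_lim_seq (digamma_seq s).
Proof.
  intros Hs.
  assert (P : forall n, 0 < s + INR n) by (intros n; generalize (pos_INR n); lra).
  apply ex_finite_lim_seq_decr with (ln s - / s).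
  - intros n. unfold digamma_seq. cbn [psum].
    assert (Pn := P n). assert (PS := P (S n)). rewrite S_INR in *.
    assert (H := ln_le_sub_1 ((s + (INR n + 1)) / (s + INR n)) ltac:(apply Rdiv_lt_0_compat; lra)).
    rewrite ln_div in H by lra.
    replace ((s + (INR n + 1)) / (s + INR n) - 1) with (/ (s + INR n)) in H by (field; lra).
    lra.
  - intros n.
    (* Subtracting one more term turns the decreasing sequence into an increasing one, whose value
       at 0 is the lower bound. *)
    assert (L : ln s - / s <= digamma_seq s n - / (s + INR n)).
    { unfold digamma_seq. induction n.
      - simpl. rewrite Rplus_0_r. lra.
      - cbn [psum]. assert (Pn := P n). assert (PS := P (S n)). rewrite S_INR in *.
        assert (H := ln_le_sub_1 ((s + INR n) / (s + (INR n + 1))) ltac:(apply Rdiv_lt_0_compat; lra)).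
        rewrite ln_div in H by lra.
        replace ((s + INR n) / (s + (INR n + 1)) - 1) with (- / (s + (INR n + 1))) in H by (field; lra).
        lra. }
    assert (0 < / (s + INR n)) by (apply Rinv_0_lt_compat, P). lra.
Qed.

(** With c = s + k >= s, the term 1/c^2 is at most (s+1)/s times 1/c - 1/(c+1), and these
    telescope. *)
Lemma psum_inv_sqr_le (s : R) (n : nat) : 0 < s ->
  psum (fun k => / (s + INR k) ^ 2) n <= (s + 1) / s * / s.
Proof.
  intros Hs.
  assert (P : forall n, 0 < s + INR n) by (intros k; generalize (pos_INR k); lra).
  assert (H : psum (fun k => / (s + INR k) ^ 2) n <= (s + 1) / s * (/ s - / (s + INR n))).
  { induction n as [|n IH].
    - simpl. right. field. lra.
    - cbn [psum]. apply Rle_trans with (1 := Rplus_le_compat_r _ _ _ IH).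
      assert (Pn := P n). assert (In := pos_INR n). rewrite S_INR.
      set (c := s + INR n) in *. replace (s + (INR n + 1)) with (c + 1) by (unfold c; ring).
      assert (H : / c ^ 2 <= (s + 1) / s * (/ c - / (c + 1))).
      { replace ((s + 1) / s * (/ c - / (c + 1))) with (/ c ^ 2 * ((s + 1) * c / (s * (c + 1))))
          by (field; lra).
        rewrite <- (Rmult_1_r (/ c ^ 2)) at 1. apply Rmult_le_compat_l.
        - left. apply Rinv_0_lt_compat. nra.
        - apply Rle_div_r; [nra|]. unfold c in *. nra. }
      lra. }
  apply Rle_trans with (1 := H). apply Rmult_le_compat_l.
  - left. apply Rdiv_lt_0_compat; lra.
  - assert (0 < / (s + INR n)) by (apply Rinv_0_lt_compat, P). lra.
Qed.

Lemma ln_Gamma_add_nat (s : R) (n : nat) : 0 < s ->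
  ln (Gamma (s + INR n)) = ln (Gamma s) + psum (fun k => ln (s + INR k)) n.
Proof.
  intros Hs. induction n as [|n IH].
  - simpl. rewrite !Rplus_0_r. reflexivity.
  - rewrite S_INR. cbn [psum]. replace (s + (INR n + 1)) with (s + INR n + 1) by ring.
    rewrite ln_Gamma_succ, IH by (generalize (pos_INR n); lra). ring.
Qed.

Lemma ln_add_sub_bounds (u h : R) : 0 < u -> - u / 2 <= h ->
  h * / u - 2 * h ^ 2 * / u ^ 2 <= ln (u + h) - ln u <= h * / u.
Proof.
  intros Hu Hh. rewrite <- ln_div by lra. split.
  - assert (H := ln_le_sub_1 (u / (u + h)) ltac:(apply Rdiv_lt_0_compat; lra)).
    rewrite ln_div in H by lra. rewrite ln_div by lra.
    assert (h * / u - 2 * h ^ 2 * / u ^ 2 <= 1 - u / (u + h)); [|lra].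
    (* The factor 2 in the quadratic term produces [u + 2 * h], nonnegative because
       [- u / 2 <= h]. *)
    assert (E : 1 - u / (u + h) - (h * / u - 2 * h ^ 2 * / u ^ 2)
      = h ^ 2 * (u + 2 * h) * / (u ^ 2 * (u + h))) by (field; lra).
    assert (0 <= h ^ 2 * (u + 2 * h) * / (u ^ 2 * (u + h))); [|lra].
    apply Rmult_le_pos; [apply Rmult_le_pos; [apply pow2_ge_0 | lra]|].
    left. apply Rinv_0_lt_compat, Rmult_lt_0_compat; [now apply pow_lt | lra].
  - replace (h * / u) with ((u + h) / u - 1) by (field; lra).
    apply ln_le_sub_1, Rdiv_lt_0_compat; lra.
Qed.

(* Compares [ln Gamma (s + h + n) - ln Gamma (s + n)], known up to o(1), with
   its expansion through the functional equation. *)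
Lemma ln_Gamma_taylor (s h psi : R) : 0 < s -> Rabs h <= s / 2 ->
  is_lim_seq (digamma_seq s) psi ->
  0 <= ln (Gamma (s + h)) - ln (Gamma s) - h * psi <= h ^ 2 * (2 * ((s + 1) / s * / s)).
Proof.
  intros Hs Hh Hpsi. apply Rabs_le_between in Hh.
  set (d := ln (Gamma (s + h)) - ln (Gamma s)).
  pose (A := fun n => ln (Gamma (s + INR n + h)) - ln (Gamma (s + INR n))
     - h * ln (s + INR n)).
  assert (HA : is_lim_seq A 0) by exact (is_lim_seq_Gamma_ratio s h Hs ltac:(lra)).
  assert (HL : is_lim_seq (fun n => d - h * digamma_seq s n - A n) (d - h * psi - 0)).
  { apply is_lim_seq_minus'; [|exact HA].
    apply is_lim_seq_minus'; [apply is_lim_seq_const|].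
    now apply (is_lim_seq_scal_l _ h psi). }
  (* By the functional equation this quantity is the sum over k < n of h/(s+k) - (ln(s+k+h) -
     ln(s+k)), each term being O(h^2/(s+k)^2). *)
  assert (HB : forall n, 0 <= d - h * digamma_seq s n - A n <= h ^ 2 * (2 * ((s + 1) / s * / s))).
  { intros n. assert (W := psum_inv_sqr_le s n Hs).
    assert (X : 0 <= d - h * digamma_seq s n - A n
       <= 2 * h ^ 2 * psum (fun k => / (s + INR k) ^ 2) n); [|nra].
    clear W. unfold d, A, digamma_seq. replace (s + INR n + h) with (s + h + INR n) by ring.
    rewrite !ln_Gamma_add_nat by lra.
    induction n as [|n IH]; cbn [psum].
    - simpl. lra.
    - assert (In := pos_INR n).
      assert (B := ln_add_sub_bounds (s + INR n) h ltac:(lra) ltac:(lra)).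
      replace (s + INR n + h) with (s + h + INR n) in B by ring. lra. }
  rewrite Rminus_0_r in HL. split.
  - refine (is_lim_seq_le (fun _ => 0) _ 0 (d - h * psi) _ (is_lim_seq_const _) HL).
    intros n; apply HB.
  - refine (is_lim_seq_le _ (fun _ => h ^ 2 * (2 * ((s + 1) / s * / s))) (d - h * psi)
      (h ^ 2 * (2 * ((s + 1) / s * / s))) _ HL (is_lim_seq_const _)).
    intros n; apply HB.
Qed.

Lemma is_derive_ln_Gamma (s psi : R) : 0 < s ->
  is_lim_seq (digamma_seq s) psi -> is_derive (fun t => ln (Gamma t)) s psi.
Proof.
  intros Hs Hpsi. apply is_derive_Reals. intros eps Heps.
  set (C := 2 * ((s + 1) / s * / s)).
  assert (HC : 0 < C).
  { unfold C. assert (0 < (s + 1) / s) by (apply Rdiv_lt_0_compat; lra).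
    assert (0 < / s) by now apply Rinv_0_lt_compat. nra. }
  (* [s / 2] is the range of [ln_Gamma_taylor]; [eps / C] makes its remainder [C * h ^ 2] smaller
     than [eps * Rabs h]. *)
  assert (Hd : 0 < Rmin (s / 2) (eps / C)).
  { apply Rmin_pos; [lra|]. now apply Rdiv_lt_0_compat. }
  exists (mkposreal _ Hd). simpl. intros h Hh0 Hh.
  assert (H1 : Rabs h <= s / 2) by (left; apply Rlt_le_trans with (1 := Hh), Rmin_l).
  assert (H2 : Rabs h < eps / C) by (apply Rlt_le_trans with (1 := Hh), Rmin_r).
  assert (T := ln_Gamma_taylor s h psi Hs H1 Hpsi). fold C in T.
  replace ((ln (Gamma (s + h)) - ln (Gamma s)) / h - psi)
    with ((ln (Gamma (s + h)) - ln (Gamma s) - h * psi) / h) by (field; auto).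
  unfold Rdiv. rewrite Rabs_mult, Rabs_inv, Rabs_pos_eq by lra.
  assert (Ph : 0 < Rabs h) by now apply Rabs_pos_lt.
  apply Rlt_div_l; [exact Ph|].
  rewrite <- pow2_abs in T. apply Rlt_div_r in H2; [|exact HC].
  nra.
Qed.

(** Near [s], [Gamma] is the exponential of its logarithm, so the limit of the approximants is its
    logarithmic derivative. *)
Lemma is_lim_seq_digamma (s : R) : 0 < s ->
  is_lim_seq (digamma_seq s) (digamma s).
Proof.
  intros Hs. destruct (ex_finite_lim_digamma_seq s Hs) as [psi Hpsi].
  assert (H : is_derive Gamma s (psi * Gamma s)).
  { apply (is_derive_ext_loc (fun t => exp (ln (Gamma t)))).
    - exists (mkposreal s Hs). intros t Ht.
      unfold ball in Ht; simpl in Ht; unfold AbsRing_ball, abs, minus, plus, opp in Ht; simpl in Ht.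
      apply Rabs_def2 in Ht. apply exp_ln, Gamma_pos. lra.
    - replace (psi * Gamma s) with (scal psi (exp (ln (Gamma s)))).
      + apply (is_derive_comp exp (fun t => ln (Gamma t))).
        * apply is_derive_exp.
        * now apply is_derive_ln_Gamma.
      + rewrite exp_ln by now apply Gamma_pos. reflexivity. }
  unfold digamma. rewrite (is_derive_unique _ _ _ H).
  replace (psi * Gamma s / Gamma s) with psi; [exact Hpsi|].
  field. apply Rgt_not_eq, Gamma_pos, Hs.
Qed.

(** [digamma_seq 1 n] is ln(n+1) minus the n-th harmonic number, and ln(n+1) - ln n tends to 0. *)
Lemma euler_gamma_digamma : euler_gamma = - digamma 1.
Proof.
  unfold euler_gamma. rewrite (is_lim_seq_unique _ (- digamma 1)); [reflexivity|].
  assert (L := is_lim_seq_digamma 1 Rlt_0_1).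
  assert (K := is_lim_seq_ln_shift 1 0).
  assert (M := is_lim_seq_minus' _ _ _ _ K L).
  rewrite Rminus_0_l in M. revert M. apply is_lim_seq_ext. intros n.
  assert (E : sum_n_m (fun k => / INR k) 1 n = psum (fun k => / (1 + INR k)) n).
  { induction n as [|n IH].
    - now rewrite sum_n_m_zero by lia.
    - rewrite sum_n_Sm, IH by lia. rewrite S_INR, Rplus_comm with (r1 := INR n). reflexivity. }
  rewrite E. unfold digamma_seq. rewrite Rplus_0_l. ring.
Qed.

(** * The coefficients of the hypergeometric series *)

(* [Beta a b] times the n-th coefficient of [hyp2F1 a b (a + b)], see
   [Beta_coeff]; this form makes the dependence on [a] visible. *)
Definition beta_coeff (a b : R) (n : nat) : R :=
  Gamma (a + INR n) * Gamma (b + INR n) / (Gamma (a + b + INR n) * Gamma (1 + INR n)).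

Lemma beta_coeff_sym (a b : R) (n : nat) : beta_coeff a b n = beta_coeff b a n.
Proof.
  unfold beta_coeff. rewrite (Rplus_comm b a).
  now rewrite (Rmult_comm (Gamma (b + INR n))).
Qed.

Lemma add_INR_pos (a : R) (n : nat) : 0 < a -> 0 < a + INR n.
Proof. generalize (pos_INR n). lra. Qed.

Lemma Gamma_add_INR_pos (a : R) (n : nat) : 0 < a -> 0 < Gamma (a + INR n).
Proof. intros Ha. now apply Gamma_pos, add_INR_pos. Qed.

Lemma Gamma_add_INR_S (a : R) (n : nat) : 0 < a ->
  Gamma (a + INR (S n)) = (a + INR n) * Gamma (a + INR n).
Proof.
  intros Ha. rewrite S_INR, <- Rplus_assoc.
  now apply Gamma_succ, add_INR_pos.
Qed.

Section BetaCoeff.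

Variables a b : R.
Hypotheses (Ha : 0 < a) (Hb : 0 < b).

Lemma beta_coeff_pos (n : nat) : 0 < beta_coeff a b n.
Proof.
  unfold beta_coeff. apply Rdiv_lt_0_compat; apply Rmult_lt_0_compat;
    apply Gamma_add_INR_pos; lra.
Qed.

Lemma beta_coeff_S (n : nat) :
  beta_coeff a b (S n) =
  beta_coeff a b n * ((a + INR n) * (b + INR n) / ((a + b + INR n) * (1 + INR n))).
Proof.
  unfold beta_coeff. rewrite !Gamma_add_INR_S by lra.
  assert (Hab : 0 < a + b) by lra.
  assert (H1 := Gamma_add_INR_pos _ n Hab).
  assert (H2 := Gamma_add_INR_pos _ n Rlt_0_1).
  assert (H3 := add_INR_pos _ n Hab). assert (H4 := add_INR_pos _ n Rlt_0_1).
  field. repeat split; lra.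
Qed.

Lemma beta_coeff_shift (n : nat) :
  beta_coeff (a + 1) b n = beta_coeff a b n * ((a + INR n) / (a + b + INR n)).
Proof.
  unfold beta_coeff.
  replace (a + 1 + INR n) with (a + INR n + 1) by ring.
  replace (a + 1 + b + INR n) with (a + b + INR n + 1) by ring.
  assert (Hab : 0 < a + b) by lra.
  assert (H1 := Gamma_add_INR_pos _ n Hab).
  assert (H2 := Gamma_add_INR_pos _ n Rlt_0_1).
  assert (H3 := add_INR_pos _ n Hab). assert (H4 := add_INR_pos _ n Ha).
  rewrite !Gamma_succ by lra.
  field. repeat split; lra.
Qed.

Lemma Beta_coeff (n : nat) :
  beta_coeff a b n =
  Beta a b * (poch a n * poch b n / (poch (a + b) n * INR (Factorial.fact n))).
Proof.
  assert (Hab : 0 < a + b) by lra.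
  assert (P : forall k, 0 < poch (a + b) k).
  { induction k; simpl; [lra|]. apply Rmult_lt_0_compat; auto. now apply add_INR_pos. }
  induction n as [|n IH].
  - unfold beta_coeff, Beta. simpl. rewrite !Rplus_0_r, Gamma_1. field.
    apply Rgt_not_eq, Gamma_pos, Hab.
  - rewrite beta_coeff_S, IH, fact_simpl, mult_INR, S_INR. cbn [poch].
    assert (H1 := P n). assert (H2 := INR_fact_lt_0 n).
    assert (H3 := add_INR_pos _ n Hab). assert (H4 := add_INR_pos _ n Rlt_0_1).
    field. repeat split; lra.
Qed.

(** Both [q] and [p + b] lie under the chord from [p] to [q + b]; adding the two inequalities, the
    chord length cancels. *)
Lemma ln_Gamma_sub_decr (p q : R) : 0 < p < q ->
  ln (Gamma (p + b)) - ln (Gamma p) <= ln (Gamma (q + b)) - ln (Gamma q).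
Proof.
  intros Hp.
  assert (H1 := ln_Gamma_slopes p q (q + b) ltac:(lra) ltac:(lra)).
  assert (H2 := ln_Gamma_slopes p (p + b) (q + b) ltac:(lra) ltac:(lra)).
  assert (0 < q + b - p) by lra. nra.
Qed.

Lemma beta_coeff_decr (a' : R) (n : nat) : a < a' ->
  beta_coeff a' b n <= beta_coeff a b n.
Proof.
  intros H. unfold beta_coeff.
  assert (H1 := Gamma_add_INR_pos _ n Ha).
  assert (H2 : 0 < Gamma (a' + INR n)) by (apply Gamma_add_INR_pos; lra).
  assert (H3 : 0 < Gamma (a + b + INR n)) by (apply Gamma_add_INR_pos; lra).
  assert (H4 : 0 < Gamma (a' + b + INR n)) by (apply Gamma_add_INR_pos; lra).
  assert (H5 := Gamma_add_INR_pos _ n Rlt_0_1).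
  assert (H6 := Gamma_add_INR_pos _ n Hb).
  assert (K : Gamma (a' + INR n) / Gamma (a' + b + INR n)
     <= Gamma (a + INR n) / Gamma (a + b + INR n)).
  { apply Rnot_lt_le. intros K. apply ln_increasing in K; [|now apply Rdiv_lt_0_compat].
    revert K. apply Rle_not_lt. rewrite !ln_div by lra.
    assert (Hn := add_INR_pos _ n Ha).
    assert (D := ln_Gamma_sub_decr (a + INR n) (a' + INR n) ltac:(lra)).
    replace (a + b + INR n) with (a + INR n + b) by ring.
    replace (a' + b + INR n) with (a' + INR n + b) by ring. lra. }
  replace (Gamma (a' + INR n) * Gamma (b + INR n) / (Gamma (a' + b + INR n) * Gamma (1 + INR n)))
    with (Gamma (a' + INR n) / Gamma (a' + b + INR n) * (Gamma (b + INR n) / Gamma (1 + INR n)))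
    by (field; lra).
  replace (Gamma (a + INR n) * Gamma (b + INR n) / (Gamma (a + b + INR n) * Gamma (1 + INR n)))
    with (Gamma (a + INR n) / Gamma (a + b + INR n) * (Gamma (b + INR n) / Gamma (1 + INR n)))
    by (field; lra).
  apply Rmult_le_compat_r; [|exact K]. left. now apply Rdiv_lt_0_compat.
Qed.

(** This increment has three uses: the monotonicity of n e_n, the telescoping in
    [psum_beta_coeff_shift], and the coefficients of (1-x) F'(x). *)
Lemma INR_mul_beta_coeff_S (n : nat) :
  INR (S n) * beta_coeff a b (S n) - INR n * beta_coeff a b n
  = beta_coeff a b n * (a * b / (a + b + INR n)).
Proof.
  rewrite beta_coeff_S, S_INR.
  assert (H3 := add_INR_pos _ n Rlt_0_1).
  assert (H4 := add_INR_pos (a + b) n ltac:(lra)).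
  field. lra.
Qed.

(** Gamma(b+n)/Gamma(a+b+n) behaves as (a+b+n)^(-a) and Gamma(a+n)/Gamma(1+n) as (1+n)^(a-1). [L3]
    and [L4] bring the bases a+b+n and n to 1+n, where all powers cancel. *)
Lemma is_lim_seq_INR_mul_beta_coeff :
  is_lim_seq (fun n => INR n * beta_coeff a b n) 1.
Proof.
  assert (L1 := is_lim_seq_Gamma_ratio (a + b) (- a) ltac:(lra) ltac:(lra)).
  assert (L2 := is_lim_seq_Gamma_ratio 1 (a - 1) ltac:(lra) ltac:(lra)).
  assert (L3 := is_lim_seq_ln_shift (a + b) 1).
  assert (L4 := is_lim_seq_ln_shift 0 1).
  apply (is_lim_seq_scal_l _ (- a)) in L3.
  assert (L := is_lim_seq_plus' _ _ _ _ (is_lim_seq_plus' _ _ _ _ L1 L2)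
     (is_lim_seq_plus' _ _ _ _ L3 L4)).
  replace (0 + 0 + (- a * 0 + 0)) with 0 in L by ring.
  apply (is_lim_seq_continuous exp) in L.
  2:{ apply derivable_continuous_pt, derivable_pt_exp. }
  rewrite exp_0 in L. revert L. apply is_lim_seq_ext_loc.
  exists 1%nat. intros n Hn. apply le_INR in Hn. simpl in Hn.
  replace (a + b + INR n + - a) with (b + INR n) by ring.
  replace (1 + INR n + (a - 1)) with (a + INR n) by ring.
  assert (H1 := Gamma_add_INR_pos _ n Ha).
  assert (H2 := Gamma_add_INR_pos _ n Hb).
  assert (H3 : 0 < Gamma (a + b + INR n)) by (apply Gamma_add_INR_pos; lra).
  assert (H4 := Gamma_add_INR_pos _ n Rlt_0_1).
  rewrite <- (exp_ln (INR n * beta_coeff a b n))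
    by (apply Rmult_lt_0_compat; [lra | apply beta_coeff_pos]).
  f_equal. unfold beta_coeff.
  rewrite ln_mult, ln_div, !ln_mult; try nra; try lra.
  2:{ apply Rdiv_lt_0_compat; nra. }
  replace (0 + INR n) with (INR n) by ring. ring.
Qed.

End BetaCoeff.

Lemma INR_mul_beta_coeff_lt_1 (a b : R) (n : nat) : 0 < a -> 0 < b ->
  INR n * beta_coeff a b n < 1.
Proof.
  intros Ha Hb.
  assert (Hlt : forall m, INR m * beta_coeff a b m < INR (S m) * beta_coeff a b (S m)).
  { intros m. apply Rlt_0_minus. rewrite INR_mul_beta_coeff_S by lra.
    apply Rmult_lt_0_compat; [now apply beta_coeff_pos|].
    apply Rdiv_lt_0_compat; [nra | apply add_INR_pos; lra]. }
  (* One step up the strictly increasing sequence makes the bound by its limit strict. *)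
  apply Rlt_le_trans with (1 := Hlt n).
  apply (is_lim_seq_incr_compare (fun m => INR m * beta_coeff a b m)).
  - now apply is_lim_seq_INR_mul_beta_coeff.
  - intros m. left. apply Hlt.
Qed.

(** By [beta_coeff_shift], e_n(a,b) - e_n(a+1,b) = e_n(a,b) b/(a+b+n), which is 1/a times the
    increment of n e_n. *)
Lemma psum_beta_coeff_shift (a b : R) (N : nat) : 0 < a -> 0 < b ->
  psum (beta_coeff a b) N =
  psum (beta_coeff (a + 1) b) N + INR N * beta_coeff a b N / a.
Proof.
  intros Ha Hb. induction N as [|N IH].
  - simpl. field. lra.
  - cbn [psum]. rewrite IH, beta_coeff_shift by lra.
    assert (E := INR_mul_beta_coeff_S a b Ha Hb N).
    assert (HN := add_INR_pos (a + b) N ltac:(lra)).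
    replace (INR (S N) * beta_coeff a b (S N)) with
      (INR N * beta_coeff a b N + beta_coeff a b N * (a * b / (a + b + INR N))) by lra.
    field. lra.
Qed.

Lemma psum_beta_coeff_shift_nat (a b : R) (N m : nat) : 0 < a -> 0 < b ->
  psum (beta_coeff a b) N = psum (beta_coeff (a + INR m) b) N
    + psum (fun k => INR N * beta_coeff (a + INR k) b N / (a + INR k)) m.
Proof.
  intros Ha Hb. induction m as [|m IH].
  - simpl. now rewrite !Rplus_0_r.
  - cbn [psum]. rewrite IH. replace (a + INR (S m)) with (a + INR m + 1) by (rewrite S_INR; ring).
    rewrite (psum_beta_coeff_shift (a + INR m)) by (auto using add_INR_pos). ring.
Qed.

(* Shifting the first parameter far enough makes the difference of the two sums
   explicit up to a quantity whose sign is known by monotonicity; this is the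
   Bohr-Mollerup argument for the digamma function. *)
Lemma psum_beta_coeff_sub_ge (a b eps : R) : 0 < a -> 0 < b -> 0 < eps ->
  eventually (fun N => digamma 1 - digamma a - eps
    <= psum (beta_coeff a b) N - psum (beta_coeff 1 b) N).
Proof.
  intros Ha Hb Heps.
  (* With [J] extra shifts, the parameter reached from 1 exceeds the one reached from [a], as
     monotonicity requires in [H1]. *)
  destruct (INR_unbounded a) as [J HJ].
  pose (rho := fun m => psum (fun k => / (a + INR k)) m - psum (fun k => / (1 + INR k)) (m + J)).
  assert (Hrho : is_lim_seq rho (digamma 1 - digamma a)).
  { assert (L1 := is_lim_seq_digamma a Ha).
    assert (L2 := is_lim_seq_digamma 1 Rlt_0_1).
    apply (is_lim_seq_incr_n _ J) in L2.
    assert (L3 := is_lim_seq_ln_shift a (1 + INR J)).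
    assert (L := is_lim_seq_plus' _ _ _ _ L3 (is_lim_seq_minus' _ _ _ _ L2 L1)).
    rewrite Rplus_0_l in L. revert L. apply is_lim_seq_ext. intros m.
    unfold digamma_seq, rho. rewrite plus_INR.
    replace (1 + INR J + INR m) with (1 + (INR m + INR J)) by ring. ring. }
  (* Half of [eps] is spent on fixing [m], the other half on letting [N] grow with [m] fixed. *)
  assert (He : 0 < eps / 2) by lra.
  assert (Hm := Hrho). apply is_lim_seq_spec in Hm. specialize (Hm (mkposreal _ He)).
  destruct Hm as [m Hm]. specialize (Hm m (le_n m)). simpl in Hm.
  assert (HN : is_lim_seq
    (fun N => psum (fun k => INR N * beta_coeff (a + INR k) b N / (a + INR k)) m)
    (psum (fun k => / (a + INR k)) m)).
  { apply (is_lim_seq_psum (fun N k => INR N * beta_coeff (a + INR k) b N / (a + INR k))).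
    intros k.
    assert (L := is_lim_seq_INR_mul_beta_coeff (a + INR k) b (add_INR_pos a k Ha) Hb).
    apply (is_lim_seq_scal_r _ (/ (a + INR k))) in L.
    replace (/ (a + INR k)) with (1 * / (a + INR k)) by ring. exact L. }
  apply is_lim_seq_spec in HN. specialize (HN (mkposreal _ He)). revert HN.
  apply filter_imp. intros N HN. simpl in HN.
  rewrite (psum_beta_coeff_shift_nat a b N m) by lra.
  rewrite (psum_beta_coeff_shift_nat 1 b N (m + J)) by lra.
  assert (H1 : psum (beta_coeff (1 + INR (m + J)) b) N <= psum (beta_coeff (a + INR m) b) N).
  { apply psum_le. intros k. apply beta_coeff_decr; try lra.
    - now apply add_INR_pos.
    - rewrite plus_INR. lra. }
  (* The corrections from 1 are bounded for every [N]; only those from [a] need the limit. *)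
  assert (H2 : psum (fun k => INR N * beta_coeff (1 + INR k) b N / (1 + INR k)) (m + J)
    <= psum (fun k => / (1 + INR k)) (m + J)).
  { apply psum_le. intros k. assert (Hk := add_INR_pos 1 k Rlt_0_1).
    assert (HT := INR_mul_beta_coeff_lt_1 (1 + INR k) b N Hk Hb).
    rewrite <- (Rmult_1_l (/ _)). apply Rmult_le_compat_r; [|lra].
    left. now apply Rinv_0_lt_compat. }
  apply Rabs_def2 in Hm. apply Rabs_def2 in HN. unfold rho in Hm. lra.
Qed.

Lemma beta_coeff_1_1 (n : nat) : beta_coeff 1 1 n = / (1 + INR n).
Proof.
  unfold beta_coeff. replace (1 + 1 + INR n) with (1 + INR n + 1) by ring.
  assert (H := add_INR_pos 1 n Rlt_0_1). rewrite Gamma_succ by lra.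
  assert (H1 := Gamma_pos _ H). field. lra.
Qed.

Lemma Ramanujan_R_digamma (a b : R) :
  Ramanujan_R a b = (digamma 1 - digamma a) + (digamma 1 - digamma b).
Proof. unfold Ramanujan_R. rewrite euler_gamma_digamma. ring. Qed.

(** The right-hand side decreases in [n], so a bound at arbitrarily large indices suffices. There,
    up to [eps], (a,b) is compared with (1,b), and (b,1) with (1,1). *)
Lemma Ramanujan_R_le_psum (a b : R) (n : nat) : 0 < a -> 0 < b ->
  Ramanujan_R a b <= psum (beta_coeff a b) (S n) - psum (fun k => / (1 + INR k)) n.
Proof.
  intros Ha Hb.
  set (w := fun n => psum (beta_coeff a b) (S n) - psum (fun k => / (1 + INR k)) n).
  change (Ramanujan_R a b <= w n).
  assert (Hw : forall m d, w (m + d)%nat <= w m).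
  { intros m d. induction d as [|d IH]; [rewrite Nat.add_0_r; lra|].
    apply Rle_trans with (2 := IH). rewrite Nat.add_succ_r.
    generalize (m + d)%nat. intros k. unfold w. cbn [psum].
    assert (HT := INR_mul_beta_coeff_lt_1 a b (S k) Ha Hb). rewrite S_INR in HT.
    assert (Hk := add_INR_pos 1 k Rlt_0_1).
    assert (beta_coeff a b (S k) < / (1 + INR k)); [|lra].
    apply Rmult_lt_reg_l with (1 + INR k); [lra|]. rewrite Rinv_r; lra. }
  apply le_epsilon. intros eps Heps. assert (He : 0 < eps / 2) by lra.
  destruct (filter_and _ _ (psum_beta_coeff_sub_ge a b _ Ha Hb He)
    (psum_beta_coeff_sub_ge b 1 _ Hb Rlt_0_1 He)) as [N HN].
  destruct (HN (n + N)%nat ltac:(lia)) as [H1 H2].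
  rewrite (psum_ext _ _ _ beta_coeff_1_1) in H2.
  rewrite (psum_ext _ _ _ (beta_coeff_sym b 1)) in H2.
  assert (H3 := Hw n N). assert (H4 := beta_coeff_pos a b Ha Hb (n + N)).
  rewrite Ramanujan_R_digamma. unfold w in *. cbn [psum] in *. lra.
Qed.

(** * The zero-balanced hypergeometric function *)

Lemma CV_radius_gt_of_bounded (u : nat -> R) (K x : R) :
  (forall n, Rabs (u n) <= K) -> 0 <= x < 1 -> Rbar_lt (Rabs x) (CV_radius u).
Proof.
  intros Hu Hx. apply Rbar_lt_le_trans with 1.
  - simpl. rewrite Rabs_pos_eq; lra.
  - apply (CV_radius_bounded u). exists K. intros n. rewrite pow1, Rmult_1_r. apply Hu.
Qed.

Lemma is_series_PSeries (u : nat -> R) (x : R) :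
  Rbar_lt (Rabs x) (CV_radius u) -> is_series (fun n => u n * x ^ n) (PSeries u x).
Proof.
  intros H. apply (proj1 (is_pseries_R u x _)), PSeries_correct, CV_radius_inside, H.
Qed.

(** The partial sums of [v n - u n] increase, so the gap at index [k] survives in the limit. *)
Lemma is_series_lt (u v : nat -> R) (lu lv : R) (k : nat) :
  (forall n, u n <= v n) -> u k < v k -> is_series u lu -> is_series v lv -> lu < lv.
Proof.
  intros Hle Hlt Hu Hv.
  assert (H := is_series_minus _ _ _ _ Hv Hu).
  assert (Hk : v k - u k <= lv - lu).
  { apply Rle_trans with (sum_n (fun n => v n - u n) k).
    - destruct k; [rewrite sum_O; lra|]. rewrite sum_Sn.
      assert (0 <= sum_n (fun n => v n - u n) k); [|unfold plus; simpl; lra].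
      rewrite sum_n_psum. generalize (S k). intros m.
      induction m as [|m IH]; simpl; [lra|]. specialize (Hle m). lra.
    - apply (is_lim_seq_incr_compare (sum_n (fun n => v n - u n))); [exact H|].
      intros n. rewrite sum_Sn. specialize (Hle (S n)). unfold plus; simpl; lra. }
  lra.
Qed.

(* The term of index 0 is [/ 0 = 0]. *)
Lemma PSeries_inv_INR (x : R) : 0 <= x < 1 ->
  Rbar_lt (Rabs x) (CV_radius (fun n => / INR n)) /\
  PSeries (fun n => / INR n) x = - ln (1 - x).
Proof.
  set (l := fun n => / INR n).
  assert (CV : forall t, 0 <= t < 1 -> Rbar_lt (Rabs t) (CV_radius l)).
  { intros t. apply CV_radius_gt_of_bounded with 1. intros [|n]; unfold l.
    - simpl. rewrite Rinv_0, Rabs_R0. lra.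
    - rewrite S_INR. assert (H := pos_INR n). rewrite Rabs_inv, Rabs_pos_eq by lra.
      rewrite <- Rinv_1. apply Rinv_le_contravar; lra. }
  intros Hx. split; [now apply CV|].
  (* The formal derivative has all coefficients 1, a geometric series, so the sum with [ln (1 - t)]
     is constant. *)
  assert (Hd : forall t, 0 <= t <= x ->
    is_derive (fun t => PSeries l t + ln (1 - t)) t 0).
  { intros t Ht.
    assert (H := is_derive_PSeries l t (CV t ltac:(lra))).
    assert (E : PSeries (PS_derive l) t = / (1 - t)).
    { apply is_series_unique. apply is_series_ext with (fun n => t ^ n).
      - intros n. unfold PS_derive, l. rewrite Rinv_r, Rmult_1_l; [reflexivity|].
        apply not_0_INR. discriminate.
      - apply is_series_geom. rewrite Rabs_pos_eq; lra. }
    replace 0 with (plus (PSeries (PS_derive l) t) (- / (1 - t)))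
      by (unfold plus; simpl; rewrite E; ring).
    apply (is_derive_plus (V := R_NormedModule)); [exact H|].
    auto_derive; [lra|]. field. lra. }
  destruct (MVT_gen (fun t => PSeries l t + ln (1 - t)) 0 x (fun _ => 0)) as (c & _ & Hc).
  - intros t. rewrite Rmin_left, Rmax_right by lra. intros Ht. apply Hd. lra.
  - intros t. rewrite Rmin_left, Rmax_right by lra. intros Ht.
    apply derivable_continuous_pt. exists 0. apply is_derive_Reals, Hd, Ht.
  - rewrite PSeries_0, Rminus_0_r, ln_1 in Hc. unfold l in Hc at 2. simpl in Hc. rewrite Rinv_0 in Hc. lra.
Qed.

Section BetaSeries.

Variables a b : R.
Hypotheses (Ha : 0 < a) (Hb : 0 < b).

Lemma beta_coeff_0 : beta_coeff a b 0 = Beta a b.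
Proof. rewrite (Beta_coeff a b Ha Hb 0). simpl. field. Qed.

Lemma Beta_pos : 0 < Beta a b.
Proof. rewrite <- beta_coeff_0. now apply beta_coeff_pos. Qed.

Lemma PSeries_beta_coeff (x : R) :
  PSeries (beta_coeff a b) x = Beta a b * hyp2F1 a b (a + b) x.
Proof.
  unfold hyp2F1. rewrite <- PSeries_scal. apply PSeries_ext. intros n.
  now rewrite Beta_coeff.
Qed.

Lemma beta_coeff_S_lt (n : nat) : beta_coeff a b (S n) < / INR (S n).
Proof.
  assert (H := INR_mul_beta_coeff_lt_1 a b (S n) Ha Hb).
  assert (0 < INR (S n)) by (apply lt_0_INR; lia).
  apply Rmult_lt_reg_l with (INR (S n)); [lra|]. rewrite Rinv_r; lra.
Qed.

Lemma CV_radius_beta_coeff (x : R) : 0 <= x < 1 ->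
  Rbar_lt (Rabs x) (CV_radius (beta_coeff a b)).
Proof.
  apply CV_radius_gt_of_bounded with (Beta a b + 1). intros n.
  assert (HB := Beta_pos). rewrite Rabs_pos_eq by (left; now apply beta_coeff_pos).
  destruct n as [|n]; [rewrite beta_coeff_0; lra|].
  assert (H := beta_coeff_S_lt n). assert (Hn := pos_INR n). rewrite S_INR in H.
  assert (/ (INR n + 1) <= 1) by (rewrite <- Rinv_1; apply Rinv_le_contravar; lra).
  lra.
Qed.

(** The expansion of Phi. As [/ INR 0] is 0, the constant coefficient is [Beta a b]; the others are
    negative by [beta_coeff_S_lt]. *)
Lemma is_series_log_corrected (x : R) : 0 <= x < 1 ->
  is_series (fun n => (beta_coeff a b n - / INR n) * x ^ n)
    (PSeries (beta_coeff a b) x + ln (1 - x)).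
Proof.
  intros Hx. destruct (PSeries_inv_INR x Hx) as [CV E].
  assert (H := is_series_minus _ _ _ _
    (is_series_PSeries _ _ (CV_radius_beta_coeff x Hx)) (is_series_PSeries _ _ CV)).
  rewrite E in H.
  replace (PSeries (beta_coeff a b) x + ln (1 - x))
    with (plus (PSeries (beta_coeff a b) x) (opp (- ln (1 - x))))
    by (unfold plus, opp; simpl; ring).
  revert H. apply is_series_ext. intros n. unfold plus, opp; simpl. ring.
Qed.

Lemma log_corrected_decr (y z : R) : 0 <= y < z -> z < 1 ->
  PSeries (beta_coeff a b) z + ln (1 - z) < PSeries (beta_coeff a b) y + ln (1 - y).
Proof.
  intros Hy Hz.
  refine (is_series_lt _ _ _ _ 1 _ _ (is_series_log_corrected z ltac:(lra))
    (is_series_log_corrected y ltac:(lra))).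
  - intros [|n]; [simpl; lra|].
    assert (H := beta_coeff_S_lt n).
    assert (y ^ S n <= z ^ S n) by (apply pow_incr; lra). nra.
  (* The linear term already makes the comparison strict. *)
  - assert (H := beta_coeff_S_lt 0). rewrite !pow_1. nra.
Qed.

Lemma PSeries_beta_coeff_0 : PSeries (beta_coeff a b) 0 = Beta a b.
Proof. now rewrite PSeries_0, beta_coeff_0. Qed.

Lemma log_corrected_lt_Beta (x : R) : 0 < x < 1 ->
  PSeries (beta_coeff a b) x + ln (1 - x) < Beta a b.
Proof.
  intros Hx. assert (H := log_corrected_decr 0 x ltac:(lra) ltac:(lra)).
  rewrite PSeries_beta_coeff_0, Rminus_0_r, ln_1 in H. lra.
Qed.

Lemma Ramanujan_R_le_log_corrected (x : R) : 0 <= x < 1 ->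
  Ramanujan_R a b <= PSeries (beta_coeff a b) x + ln (1 - x).
Proof.
  intros Hx.
  refine (is_lim_seq_le (fun _ => Ramanujan_R a b) _ (Ramanujan_R a b) (Finite _) _
    (is_lim_seq_const _) (is_series_log_corrected x Hx)).
  intros n. apply Rle_trans with (1 := Ramanujan_R_le_psum a b n Ha Hb).
  (* Beyond index 0 the coefficients are negative, so replacing each power of x by 1 only lowers the
     partial sum. *)
  rewrite sum_n_psum. induction n as [|n IH].
  - simpl. rewrite Rinv_0. lra.
  - cbn [psum] in *. assert (H := beta_coeff_S_lt n).
    assert (x ^ S n <= 1) by (rewrite <- (pow1 (S n)); apply pow_incr; lra).
    rewrite (Rplus_comm 1), <- S_INR. nra.
Qed.

Lemma is_series_one_sub_mul_derive (x : R) : 0 <= x < 1 ->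
  is_series (fun n => beta_coeff a b n * (a * b / (a + b + INR n)) * x ^ n)
    ((1 - x) * PSeries (PS_derive (beta_coeff a b)) x).
Proof.
  intros Hx. set (d := PS_derive (beta_coeff a b)).
  assert (CV : Rbar_lt (Rabs x) (CV_radius d)).
  { unfold d. rewrite CV_radius_derive. now apply CV_radius_beta_coeff. }
  assert (CV' : Rbar_lt (Rabs x) (CV_radius (PS_incr_1 d))).
  { now rewrite CV_radius_incr_1. }
  assert (H := is_series_minus _ _ _ _ (is_series_PSeries _ _ CV) (is_series_PSeries _ _ CV')).
  rewrite PSeries_incr_1 in H.
  replace ((1 - x) * PSeries d x) with (plus (PSeries d x) (opp (x * PSeries d x)))
    by (unfold plus, opp; simpl; ring).
  revert H. apply is_series_ext. intros n.
  rewrite <- INR_mul_beta_coeff_S by assumption.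
  unfold d, PS_derive, PS_incr_1, plus, opp. destruct n; cbn -[INR pow]; [|ring].
  change (INR 0) with 0. unfold zero; simpl. ring.
Qed.

Lemma one_sub_mul_derive_incr (y z : R) : 0 <= y <= z -> z < 1 ->
  (1 - y) * PSeries (PS_derive (beta_coeff a b)) y
  <= (1 - z) * PSeries (PS_derive (beta_coeff a b)) z.
Proof.
  intros Hy Hz.
  assert (Sy := is_series_one_sub_mul_derive y ltac:(lra)).
  assert (Sz := is_series_one_sub_mul_derive z ltac:(lra)).
  rewrite <- (is_series_unique _ _ Sy), <- (is_series_unique _ _ Sz).
  apply Series_le; [|now eexists; apply Sz].
  intros n.
  assert (0 <= beta_coeff a b n * (a * b / (a + b + INR n))).
  { apply Rmult_le_pos; [left; now apply beta_coeff_pos|].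
    left. apply Rdiv_lt_0_compat; [nra | apply add_INR_pos; lra]. }
  assert (0 <= y ^ n) by (apply pow_le; lra).
  assert (y ^ n <= z ^ n) by (apply pow_incr; lra).
  split; [now apply Rmult_le_pos | now apply Rmult_le_compat_l].
Qed.

Lemma PSeries_beta_coeff_add_le (x y : R) : 0 < x < 1 -> 0 < y < 1 ->
  PSeries (beta_coeff a b) x + PSeries (beta_coeff a b) y
  - PSeries (beta_coeff a b) (x + y - x * y) <= Beta a b.
Proof.
  intros Hx Hy. set (G := PSeries (beta_coeff a b)).
  set (G' := PSeries (PS_derive (beta_coeff a b))).
  assert (HG : forall t, 0 <= t < 1 -> is_derive G t (G' t)).
  { intros t Ht. now apply is_derive_PSeries, CV_radius_beta_coeff. }
  (* The mean value theorem for [g] on [0, y] reduces the claim to [g' <= 0]. *)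
  pose (g := fun t => G t - G (x + t - x * t)).
  pose (g' := fun t => G' t - (1 - x) * G' (x + t - x * t)).
  assert (Hg : forall t, 0 <= t <= y -> is_derive g t (g' t)).
  { intros t Ht. unfold g, g'.
    apply (is_derive_minus (V := R_NormedModule)); [apply HG; lra|].
    apply (is_derive_comp G (fun t => x + t - x * t)).
    - apply HG. nra.
    - auto_derive; auto. ring. }
  destruct (MVT_gen g 0 y g') as (c & Hc & E).
  - intros t. rewrite Rmin_left, Rmax_right by lra. intros Ht. apply Hg. lra.
  - intros t. rewrite Rmin_left, Rmax_right by lra. intros Ht.
    apply derivable_continuous_pt. exists (g' t). apply is_derive_Reals, Hg, Ht.
  - rewrite Rmin_left, Rmax_right in Hc by lra.
    assert (Hmono := one_sub_mul_derive_incr c (x + c - x * c) ltac:(nra) ltac:(nra)).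
    fold G' in Hmono.
    (* Since 1 - (x + c - xc) = (1-x)(1-c), the positive factor 1-c divides out of [Hmono]. *)
    assert (Hg' : g' c <= 0) by (unfold g'; nra).
    unfold g in E at 2. replace (x + 0 - x * 0) with x in E by ring.
    unfold G in E at 1. rewrite PSeries_beta_coeff_0 in E. unfold g in E. nra.
Qed.

End BetaSeries.

Theorem theorem1p6 :
  forall a b : R, 0 < a -> 0 < b ->
  forall x y : R, 0 < x < 1 -> 0 < y < 1 ->
    2 * Ramanujan_R a b / Beta a b - 1 < D_F a b x y <= 1.
Proof.
  intros a b Ha Hb x y Hx Hy.
  assert (HB := Beta_pos a b Ha Hb).
  set (z := x + y - x * y).
  assert (Hz : y < z < 1) by (unfold z; nra).
  assert (H1 := PSeries_beta_coeff_add_le a b Ha Hb x y Hx Hy). fold z in H1.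
  assert (H2 := log_corrected_decr a b Ha Hb y z ltac:(lra) ltac:(lra)).
  assert (H3 := log_corrected_lt_Beta a b Ha Hb x Hx).
  assert (H4 := Ramanujan_R_le_log_corrected a b Ha Hb x ltac:(lra)).
  assert (Hln : ln (1 - z) = ln (1 - x) + ln (1 - y)).
  { rewrite <- ln_mult by lra. f_equal. unfold z. ring. }
  rewrite !PSeries_beta_coeff in * by assumption.
  unfold D_F. fold z.
  split; apply Rmult_le_reg_l with (Beta a b) || apply Rmult_lt_reg_l with (Beta a b);
    try exact HB.
  (* [H2] leaves Phi(x) as a strict lower bound; [H4] and [H3] give R <= Phi(x) < B, so R exceeds 2R
     - B. *)
  - replace (Beta a b * (2 * Ramanujan_R a b / Beta a b - 1))
      with (2 * Ramanujan_R a b - Beta a b) by (field; lra). lra.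
  - lra.
Qed.
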